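(* The relation $E_{\mathrm{csc}}$ restricted to $\mathbb X_{0\text{-dim}}$ is Borel bi-reducible with $=^+$.
   Context: The set of all metrics on $\mathbb N$ is regarded as a subspace of $\mathbb R^{\mathbb N\times\mathbb N}$ (it carries a Polish structure). $\mathbb X_{\mathrm{cpt}}$ is the Borel set of metrics on $\mathbb N$ whose completion is compact, and $\mathbb X_{0\text{-dim}}$ is the (Borel) set of metrics on $\mathbb N$ whose completion is compact and zero-dimensional. For $d_1,d_2\in\mathbb X_{\mathrm{cpt}}$, $d_1\mathrel{E_{\mathrm{csc}}}d_2$ means that the identity map on $\mathbb N$ extends to a homeomorphism from the completion of $(\mathbb N,d_1)$ onto the completion of $(\mathbb N,d_2)$. $=^+$ is the equivalence relation on $\mathbb R^{\mathbb N}$ given by $(x_n)=^+(y_n)$ if and only if $\{x_n:n\in\mathbb N\}=\{y_n:n\in\mathbb N\}$. For equivalence relations $E,F$ on standard Borel spaces $X,Y$, $E$ is Borel-reducible to $F$ if there is a Borel map $f\colon X\to Y$ with $x_1\mathrel{E}x_2\iff f(x_1)\mathrel{F}f(x_2)$ for all $x_1,x_2\in X$. $E$ and $F$ are Borel bi-reducible if each is Borel-reducible to the other. *)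

(* Defs.v *)
From HB Require Import structures.
From mathcomp Require Import all_boot all_order all_algebra generic_quotient lra.
From mathcomp Require Import all_classical all_reals all_analysis.
Import Order.TTheory GRing.Theory Num.Theory.
Import numFieldNormedType.Exports.

Set Implicit Arguments.
Unset Strict Implicit.
Unset Printing Implicit Defensive.

Local Open Scope classical_set_scope.
Local Open Scope ring_scope.
Local Open Scope quotient_scope.

Definition borel_set (X : topologicalType) : set (set X) := <<s @open X >>.

Definition borel_map (X Y : topologicalType) (f : X -> Y) : Prop :=
  forall B : set Y, borel_set B -> borel_set (f @^-1` B).

Definition borel_reducible (X Y : topologicalType)
    (E : X -> X -> Prop) (F : Y -> Y -> Prop) : Prop :=
  exists2 f : X -> Y, borel_map f & forall x1 x2, E x1 x2 <-> F (f x1) (f x2).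

Definition borel_bireducible (X Y : topologicalType)
    (E : X -> X -> Prop) (F : Y -> Y -> Prop) : Prop :=
  borel_reducible E F /\ borel_reducible F E.

Definition eq_plus (R : realType) (x y : {ptws nat -> R}) : Prop :=
  range x = range y.

Definition is_homeomorphism (X Y : topologicalType) (f : X -> Y) : Prop :=
  continuous f /\
  exists g : Y -> X, [/\ cancel f g, cancel g f & continuous g].

(* The library's [zero_dimensional] only asks that distinct points be separated
   by a clopen set; here zero-dimensional means having a base of clopen sets. *)
Definition has_clopen_base (X : topologicalType) : Prop :=
  forall (x : X) (U : set X), nbhs x U ->
    exists V : set X, [/\ clopen V, V x & V `<=` U].

(* [metrics R], used as a type, carries the topology induced from
   the product topology on R^(N x N). *)
Definition metrics (R : realType) : set {ptws (nat * nat)%type -> R} :=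
  [set d | [/\ forall x, d (x, x) = 0,
               forall x y, d (x, y) = 0 -> x = y,
               forall x y, d (x, y) = d (y, x) &
               forall x y z, d (x, z) <= d (x, y) + d (y, z)]].
Arguments metrics R : clear implicits.

(* The completion is the set of Cauchy sequences modulo being at distance 0,
   with the distance lim_n d(u_n, v_n). *)
Section completion.
Context {R : realType} (d : metrics R).

Definition dist (x y : nat) : R := set_val d (x, y).

Definition cauchy_seqs : set (nat -> nat) :=
  [set u | forall e : R, 0 < e -> exists N : nat, forall m n : nat,
     (N <= m)%N -> (N <= n)%N -> dist (u m) (u n) < e].

Definition seq_dist (u v : cauchy_seqs) : R :=
  limn (fun n => dist (set_val u n) (set_val v n)).

Lemma distxx x : dist x x = 0.
Proof. by case: (set_valP d) => h _ _ _; exact: h. Qed.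

Lemma dist_eq0 x y : dist x y = 0 -> x = y.
Proof. by case: (set_valP d) => _ h _ _; exact: h. Qed.

Lemma distC x y : dist x y = dist y x.
Proof. by case: (set_valP d) => _ _ h _; exact: h. Qed.

Lemma dist_triangle y x z : dist x z <= dist x y + dist y z.
Proof. by case: (set_valP d) => _ _ _ h; exact: h. Qed.

Lemma dist_ge0 x y : 0 <= dist x y.
Proof. by have := dist_triangle y x x; rewrite distxx (distC y x); lra. Qed.

Lemma cauchy_seqsP (u : cauchy_seqs) e : 0 < e -> exists N : nat, forall m n,
  (N <= m)%N -> (N <= n)%N -> dist (set_val u m) (set_val u n) < e.
Proof. exact: (set_valP u). Qed.

Lemma is_cvg_seq_dist (u v : cauchy_seqs) :
  cvgn (fun n => dist (set_val u n) (set_val v n)).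
Proof.
apply/cauchy_cvgP/cauchyP => e e0.
have e2 : 0 < e / 2 by lra.
have [N hN] := cauchy_seqsP u e2; have [M hM] := cauchy_seqsP v e2.
exists (dist (set_val u (maxn N M)) (set_val v (maxn N M))).
suff: \forall n \near \oo, ball (dist (set_val u (maxn N M)) (set_val v (maxn N M)))
    e (dist (set_val u n) (set_val v n)) by [].
near=> n.
have nN : (N <= n)%N by near: n; exact: nbhs_infty_ge.
have nM : (M <= n)%N by near: n; exact: nbhs_infty_ge.
rewrite /ball /=.
have := hN _ _ (leq_maxl N M) nN; have := hM _ _ (leq_maxr N M) nM.
set a := set_val u _; set b := set_val v _.
set a' := set_val u _; set b' := set_val v _ => h1 h2.
have := dist_triangle a' a b; have := dist_triangle b' a' b.
have := dist_triangle a a' b'; have := dist_triangle b a b'.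
rewrite (distC a' a) (distC b' b) => t1 t2 t3 t4.
by rewrite ltr_norml; apply/andP; split; lra.
Unshelve. all: by end_near. Qed.

Lemma seq_distxx u : seq_dist u u = 0.
Proof.
apply: lim_near_cst => //; apply: nearW => n; exact: distxx.
Qed.

Lemma seq_distC u v : seq_dist u v = seq_dist v u.
Proof. by rewrite /seq_dist; under eq_fun do rewrite distC. Qed.

Lemma seq_dist_triangle v u w : seq_dist u w <= seq_dist u v + seq_dist v w.
Proof.
rewrite /seq_dist -limD; [|exact: is_cvg_seq_dist..].
apply: ler_lim; first exact: is_cvg_seq_dist.
  by apply: is_cvgD; exact: is_cvg_seq_dist.
by apply: nearW => n; exact: dist_triangle.
Qed.

Lemma seq_dist_ge0 u v : 0 <= seq_dist u v.
Proof. by have := seq_dist_triangle v u u; rewrite seq_distxx (seq_distC v u); lra. Qed.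

Definition seq_equiv (u v : cauchy_seqs) : bool := seq_dist u v == 0.

Lemma seq_equiv_refl : reflexive seq_equiv.
Proof. by move=> u; rewrite /seq_equiv seq_distxx. Qed.

Lemma seq_equiv_sym : symmetric seq_equiv.
Proof. by move=> u v; rewrite /seq_equiv seq_distC. Qed.

Lemma seq_equiv_trans : transitive seq_equiv.
Proof.
move=> v u w /eqP uv /eqP vw; apply/eqP.
by have := seq_dist_triangle v u w; have := seq_dist_ge0 u w; lra.
Qed.

Canonical seq_equivRel :=
  EquivRel seq_equiv seq_equiv_refl seq_equiv_sym seq_equiv_trans.

Definition completion : Type := {eq_quot seq_equiv}.

HB.instance Definition _ := Choice.on completion.
HB.instance Definition _ := EqQuotient.on completion.

Definition completion_dist (x y : completion) : R := seq_dist (repr x) (repr y).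

Lemma completion_distxx x : completion_dist x x = 0.
Proof. exact: seq_distxx. Qed.

Lemma completion_dist_eq0 x y : completion_dist x y = 0 -> x = y.
Proof. by move=> /eqP xy; rewrite -[x]reprK -[y]reprK; apply/eqmodP. Qed.

Lemma completion_distC x y : completion_dist x y = completion_dist y x.
Proof. exact: seq_distC. Qed.

Lemma completion_dist_triangle y x z :
  completion_dist x z <= completion_dist x y + completion_dist y z.
Proof. exact: seq_dist_triangle. Qed.

HB.instance Definition _ := isMetric.Build R completion completion_distxx
  completion_dist_eq0 completion_distC completion_dist_triangle.

Lemma cst_cauchy (n : nat) : cauchy_seqs (fun=> n).
Proof. by move=> e e0; exists 0 => *; rewrite distxx. Qed.

Definition cst_seq (n : nat) : cauchy_seqs := SigSub (mem_set (cst_cauchy n)).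

Definition to_completion (n : nat) : completion := \pi_completion (cst_seq n).

Lemma completion_dist_pi (u v : cauchy_seqs) :
  completion_dist (\pi_completion u) (\pi_completion v) = seq_dist u v.
Proof.
have hr w : seq_dist (repr (\pi_completion w)) w = 0.
  by apply/eqP; apply/(@eqmodP _ seq_equivRel); rewrite reprK.
rewrite /completion_dist.
set u' := repr _; set v' := repr _.
have := hr u; have := hr v; rewrite -/u' -/v' => hv hu.
have := seq_dist_triangle u u' v'; have := seq_dist_triangle v u v'.
have := seq_dist_triangle u' u v; have := seq_dist_triangle v' u' v.
by rewrite (seq_distC u u') (seq_distC v v') hu hv; lra.
Qed.

Lemma to_completion_isometry m n :
  mdist (to_completion m) (to_completion n) = dist m n.
Proof.
rewrite [LHS]completion_dist_pi; apply: lim_near_cst => //.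
by apply: nearW => k; rewrite !set_valE.
Qed.

Lemma dense_to_completion (x : completion) (e : R) : 0 < e ->
  exists n, mdist (to_completion n) x < e.
Proof.
move=> e0; have e2 : 0 < e / 2 by lra.
have [N hN] := cauchy_seqsP (repr x) e2; exists (set_val (repr x) N).
rewrite -[x in mdist _ x]reprK [ltLHS]completion_dist_pi.
apply: (@le_lt_trans _ _ (e / 2)); last lra.
apply: limr_le; first exact: is_cvg_seq_dist.
near=> k; rewrite !set_valE/=; apply/ltW.
by apply: hN => //; near: k; exact: nbhs_infty_ge.
Unshelve. all: by end_near. Qed.

HB.instance Definition _ := isPointed.Build completion (to_completion 0).

Lemma completion_cauchy_cvg (F : set_system completion) :
  ProperFilter F -> cauchy F -> cvg F.
Proof.
move=> FF /cauchyP Fc.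
have [k hk] : exists k : nat -> nat, forall n,
    F (ball (to_completion (k n)) (n.+1%:R^-1 : R)).
  suff /choice [k hk] : forall n, exists k,
    F (ball (to_completion k) (n.+1%:R^-1 : R)) by exists k.
  move=> n; have n0 : (0 : R) < n.+1%:R^-1 / 2 by rewrite divr_gt0// invr_gt0 ltr0n.
  have [x Fx] := Fc _ n0; have [k kx] := dense_to_completion x n0.
  exists k; apply: filterS Fx => y xy.
  by apply: ball_splitr xy; apply: ball_sym; rewrite ballEmdist.
have dk m n : dist (k m) (k n) < m.+1%:R^-1 + n.+1%:R^-1.
  have [z [zm zn]] := filter_ex (filterI (hk m) (hk n)).
  rewrite -to_completion_isometry.
  by have := ball_triangle zm (ball_sym zn); rewrite ballEmdist.
have small e : (0 : R) < e -> exists N, forall n, (N <= n)%N -> n.+1%:R^-1 < e.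
  move=> e0.
  have [N _ hN] := near_infty_natSinv_lt (PosNum e0).
  by exists N => n /hN.
have ku : cauchy_seqs k.
  move=> e e0; have [|N hN] := small (e / 2); first lra.
  exists N => m n /hN hm /hN hn; apply: lt_trans (dk m n) _.
  by rewrite [ltRHS]splitr ltrD.
pose s : cauchy_seqs := SigSub (mem_set ku).
pose y := \pi_completion s.
have ky n : mdist (to_completion (k n)) y <= n.+1%:R^-1.
  rewrite [leLHS]completion_dist_pi; apply/ler_addgt0Pr => e e0.
  have [N hN] := small e e0.
  apply: limr_le; first exact: is_cvg_seq_dist.
  near=> m; rewrite !set_valE/=; apply: (le_trans (ltW (dk n m))).
  by rewrite lerD2l ltW// hN//; near: m; exact: nbhs_infty_ge.
apply/cvg_ex; exists y; apply/cvg_ballP => e e0.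
have [|N hN] := small (e / 2); first lra.
have {}hN := hN N (leqnn _).
apply: filterS (hk N) => z; rewrite !ballEmdist /= => kz.
have := metric_triangle y (to_completion (k N)) z.
rewrite (metric_sym y (to_completion _)) => t; apply: le_lt_trans t _.
by rewrite [ltRHS]splitr ltrD//;
  [exact: le_lt_trans (ky N) hN|exact: lt_trans kz hN].
Unshelve. all: by end_near. Qed.

HB.instance Definition _ :=
  Uniform_isComplete.Build completion completion_cauchy_cvg.
End completion.

Definition X_cpt (R : realType) : set (metrics R) :=
  [set d | compact [set: completion d]].
Arguments X_cpt R : clear implicits.

Definition X_0dim (R : realType) : set (metrics R) :=
  [set d | X_cpt R d /\ has_clopen_base (completion d)].
Arguments X_0dim R : clear implicits.

Definition E_csc (R : realType) (d1 d2 : metrics R) : Prop :=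
  exists2 f : completion d1 -> completion d2, is_homeomorphism f &
    forall n, f (to_completion d1 n) = to_completion d2 n.

(* Main.v *)
Require Import Defs.
From mathcomp Require Import all_boot all_order all_algebra generic_quotient lra.
From mathcomp Require Import all_classical all_reals all_analysis.
Import Order.TTheory GRing.Theory Num.Theory.
Import numFieldNormedType.Exports.

(** Let [d] be a metric on N with compact zero-dimensional completion. The traces
    on N of the clopen subsets of the completion are the sets [A] which are at
    positive [d]-distance from their complement ([unif_clopen d]). They determine
    the uniformity of [d], and a homeomorphism of compact completions extending
    the identity of N is the same as a uniform isomorphism, so [d1] and [d2] are
    related by [E_csc] iff [unif_clopen d1 = unif_clopen d2] ([E_cscP]).

    The algebra [unif_clopen d] is countable and has a Borel enumeration: call two
    integers chained at scale [e] if they are joined by a finite chain of steps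
    shorter than [e]. By total boundedness there are finitely many chain classes
    at each scale 1/(m+1), and the members of [unif_clopen d] are exactly the
    finite unions of chain classes ([unif_clopenP]). Coding subsets of N by reals
    in base 3 ([ternary]) turns this enumeration into a Borel reduction of [E_csc]
    to [=^+] ([clopen_code]).

    Conversely, every real [r] has a set of integers, those coding a rational
    interval that contains [r]. A sequence [x] of reals gives the ultrametric
    [split_dist x] in which [i] and [j] are at distance 1/(k+1), where [k] is the
    first index at which [i] and [j] are separated either by the singleton {k} or
    by the set of [x k]. It is totally bounded, hence has a compact
    zero-dimensional completion. The uniformity depends only on the range of [x]
    ([sub_range_unif_finer]). It also determines the range: if [r] avoids the
    range of [y], then for each [m] a short interval around [r] avoids
    [y 0], ..., [y m], and arbitrarily large integers coding this interval cannot
    be separated, up to stage [m] of [y], from integers coding the empty interval,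
    whereas the set of [r] separates them ([unif_finer_sub_range]). *)

Set Implicit Arguments.
Unset Strict Implicit.
Unset Printing Implicit Defensive.

Local Open Scope classical_set_scope.
Local Open Scope ring_scope.

(** * Borel sets and Borel maps *)

Section borel_sets.
Context {X : topologicalType}.
Implicit Types (A B : set X) (P : Prop).

Lemma borel_set_open A : open A -> borel_set A.
Proof. by move=> oA; exact: sub_sigma_algebra. Qed.

Lemma borel_setC A : borel_set A -> borel_set (~` A).
Proof. by move=> bA; rewrite -setTD; exact: sigma_algebraCD. Qed.

Lemma borel_set_exists (T : countType) (A : T -> set X) :
  (forall t, borel_set (A t)) -> borel_set [set x | exists t, A t x].
Proof.
move=> bA.
have -> : [set x | exists t, A t x] =
    \bigcup_n (if unpickle n is Some t then A t else set0).
  apply/seteqP; split => x /=.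
    by case=> t Atx; exists (pickle t); rewrite ?pickleK.
  by case=> n _; case: (unpickle n) => // t Atx; exists t.
apply: sigma_algebra_bigcup => n.
by case: (unpickle n) => [t|]; [exact: bA|exact: sigma_algebra0].
Qed.

Lemma borel_set_forall (T : countType) (A : T -> set X) :
  (forall t, borel_set (A t)) -> borel_set [set x | forall t, A t x].
Proof.
move=> bA.
have -> : [set x | forall t, A t x] = ~` [set x | exists t, (~` A t) x].
  apply/seteqP; split => x /=; first by move=> Ax [t]; apply.
  by move=> nA t; apply: contrapT => nAt; apply: nA; exists t.
by apply: borel_setC; apply: borel_set_exists => t; exact: borel_setC.
Qed.

Lemma borel_set_cst P : borel_set [set _ : X | P].
Proof.
case: (pselect P) => h.
  by rewrite (_ : [set _ | P] = setT) ?predeqE//; exact: borel_set_open openT.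
by rewrite (_ : [set _ | P] = set0) ?predeqE//; exact: borel_set_open open0.
Qed.

Lemma borel_setI A B : borel_set A -> borel_set B -> borel_set (A `&` B).
Proof.
move=> bA bB.
rewrite (_ : A `&` B = [set x | forall b : bool, (if b then A else B) x]).
  by apply: borel_set_forall => -[].
by apply/seteqP; split => x /= => [[Ax Bx] []//|h]; split;
  [exact: (h true)|exact: (h false)].
Qed.

Lemma borel_set_imply A B :
  borel_set A -> borel_set B -> borel_set [set x | A x -> B x].
Proof.
move=> bA bB; rewrite (_ : [set x | _] = ~` (A `&` ~` B)).
  by apply: borel_setC; apply: borel_setI => //; exact: borel_setC.
apply/seteqP; split => x /= => [AB [/AB]//|nAB Ax].
by apply: contrapT => nB; exact: nAB.
Qed.

Lemma borel_set_iff A B :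
  borel_set A -> borel_set B -> borel_set [set x | A x <-> B x].
Proof. by move=> bA bB; apply: borel_setI; exact: borel_set_imply. Qed.

End borel_sets.

(** The preimages of open sets suffice: the sets with Borel preimage form a
    sigma-algebra. *)
Lemma borel_mapP (X Y : topologicalType) (f : X -> Y) :
  (forall U, open U -> borel_set (f @^-1` U)) -> borel_map f.
Proof.
move=> fU B bB.
apply: (smallest_sub (C := sigma_algebra setT)
  (X := [set B | borel_set (f @^-1` B)]) _ _ bB) => //.
split=> /=.
- by rewrite preimage_set0; exact: sigma_algebra0.
- by move=> A /borel_setC; rewrite setTD.
- by move=> A bA; rewrite preimage_bigcup; exact: sigma_algebra_bigcup.
Qed.

Lemma borel_map_continuous (X Y : topologicalType) (f : X -> Y) :
  continuous f -> borel_map f.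
Proof.
by move=> /continuousP cf; apply: borel_mapP => U oU; apply: borel_set_open; exact: cf.
Qed.

Section borel_coordinates.
Context {R : realType} {I : countType}.
Implicit Types (l : seq (I * rat * rat)) (f : {ptws I -> R}).

(** The box of all [f] with [q1 < f i < q2] for every [(i, q1, q2)] in [l]. *)
Definition rational_box l : set {ptws I -> R} :=
  [set f | forall t, t \in l -> ratr t.1.2 < f t.1.1 /\ f t.1.1 < ratr t.2].

(** The rational boxes around [f] generate a filter that converges to [f]
    coordinatewise, hence in the product topology. *)
Lemma rational_box_base f U : nbhs f U ->
  exists l, rational_box l f /\ rational_box l `<=` U.
Proof.
pose F := [set V : set {ptws I -> R} |
  exists l, rational_box l f /\ rational_box l `<=` V].
have FF : Filter F.
  split.
  - by exists [::]; split.
  - move=> V W [l [lf lV]] [k [kf kW]]; exists (l ++ k); split.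
      by move=> t; rewrite mem_cat => /orP[/lf|/kf].
    move=> g lkg; split; [apply: lV|apply: kW] => t tl; apply: lkg;
    by rewrite mem_cat tl ?orbT.
  - by move=> V W VW [l [lf lV]]; exists l; split=> //; exact: subset_trans VW.
suff : {ptws, F --> f} by apply.
apply/cvg_sup => i V.
rewrite nbhsE => -[W [[B oB <-] Bfi BV]].
have /nbhs_ballP[e /= e0 eB] : nbhs (f i) B by exact: open_nbhs_nbhs.
have [|q1 hq1] := @rat_in_itvoo _ (f i - e) (f i); first lra.
have [|q2 hq2] := @rat_in_itvoo _ (f i) (f i + e); first lra.
move: hq1 hq2; rewrite !in_itv /= => /andP[? ?] /andP[? ?].
exists [:: (i, q1, q2)]; split; first by move=> t; rewrite inE => /eqP ->.
move=> g /(_ (i, q1, q2)); rewrite inE eqxx => /(_ erefl) /= [? ?].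
apply: BV; apply: eB; rewrite /ball /= ltr_norml; apply/andP; split; lra.
Qed.

(** As there are countably many rational boxes, a map into a countable power of the
    reals is Borel as soon as its coordinates are. *)
Lemma borel_map_ptws (X : topologicalType) (g : X -> {ptws I -> R}) :
  (forall i (q : rat), borel_set [set x | ratr q < g x i]) ->
  borel_map g.
Proof.
move=> gl.
have gr i (q : rat) : borel_set [set x | g x i < ratr q].
  (* g x i < q iff g x i <= q' for some rational q' < q *)
  rewrite (_ : [set x | _] = [set x | exists q' : rat,
      ratr q' < ratr q :> R /\ (~` [set x | ratr q' < g x i]) x]).
    apply: borel_set_exists => q'; apply: borel_setI; first exact: borel_set_cst.
    exact: borel_setC.
  apply/seteqP; split=> x /= => [/rat_in_itvoo[q']|[q' [q'q /negP]]].
    rewrite in_itv /= => /andP[gq' q'q]; exists q'; split=> //.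
    by apply/negP; rewrite -leNgt ltW.
  by rewrite -leNgt => gq'; exact: le_lt_trans q'q.
apply: borel_mapP => U oU.
have -> : g @^-1` U = [set x | exists l,
    (rational_box l `<=` U /\ rational_box l (g x))].
  apply/seteqP; split=> x /= => [Ugx|[l [lU lgx]]]; last exact: lU.
  have [l [? ?]] := rational_box_base (open_nbhs_nbhs (conj oU Ugx)).
  by exists l.
apply: borel_set_exists => l; apply: borel_setI; first exact: borel_set_cst.
apply: borel_set_forall => t.
by apply: (borel_set_imply (A := [set _ | t \in l])
  (B := [set x | ratr t.1.2 < g x t.1.1 /\ g x t.1.1 < ratr t.2]));
  [exact: borel_set_cst|exact: borel_setI (gl _ _) (gr _ _)].
Qed.

End borel_coordinates.

Lemma borel_set_fibres (X : topologicalType) (T : countType) (k : X -> T)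
    (B : set T) :
  (forall t, borel_set [set x | k x = t]) -> borel_set [set x | B (k x)].
Proof.
move=> bk; rewrite (_ : [set x | _] = [set x | exists t, B t /\ k x = t]).
  by apply: borel_set_exists => t; apply: borel_setI (bk t); exact: borel_set_cst.
by apply/seteqP; split=> x /= => [Bkx|[t [? ->]]//]; exists (k x).
Qed.

Lemma borel_set_eval (R : realType) (I : eqType) (i : I) (U : set R) :
  open U -> borel_set [set f : {ptws I -> R} | U (f i)].
Proof.
move=> oU; apply: borel_set_open.
by apply: (open_comp (f := fun f : {ptws I -> R} => f i)) => // f _;
  exact: proj_continuous.
Qed.

Lemma borel_map_set_val (X Y : topologicalType) (A : set Y) (f : X -> A) :
  borel_map (fun x => set_val (f x)) -> borel_map f.
Proof.
by move=> bf; apply: borel_mapP => U [V oV <-]; apply: bf; exact: borel_set_open.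
Qed.

(** * Uniformities on N and compact completions *)

Section uniformities.
Context {R : realType}.
Implicit Types d : metrics R.

(** The identity of N is uniformly continuous from [d1] to [d2]. *)
Definition unif_finer d1 d2 : Prop := forall e : R, 0 < e ->
  exists2 r : R, 0 < r & forall x y, dist d1 x y < r -> dist d2 x y < e.

Definition totally_bounded_metric d : Prop := forall e : R, 0 < e ->
  exists s : seq nat, forall y, exists2 x, x \in s & dist d x y < e.

(** [x] and [y] are joined by a finite chain of steps shorter than [e]. *)
Definition chained d (e : R) (x y : nat) : Prop :=
  exists l, path (fun a b => dist d a b < e) x l /\ last x l = y.

(** The metric form of zero-dimensionality: chains of small enough steps have small
    diameter. *)
Definition small_chains d : Prop := forall e : R, 0 < e ->
  exists2 r : R, 0 < r & forall x y, chained d r x y -> dist d x y < e.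

(** [A] is at positive distance from its complement (for compact completions, [A]
    is the trace on N of a clopen set). The condition is symmetric in [A] and its
    complement because the distance is symmetric. *)
Definition unif_clopen d (A : set nat) : Prop :=
  exists2 r : R, 0 < r & forall x y, dist d x y < r -> A x -> A y.

Lemma near0P (P : R -> Prop) : (\forall r \near (0 : R)^'+, P r) ->
  exists2 r : R, 0 < r & P r.
Proof.
move=> P0; near ((0 : R)^'+) => r; exists r => //.
by near: r.
Unshelve. all: by end_near. Qed.

(** The form of neighbourhood of [(x, 0+)] that occurs when near-covering
    compactness is used to get a uniform radius. *)
Lemma near_ballP d (x : completion d) (P : completion d -> R -> Prop) (e : R) :
  0 < e -> (forall y r, mdist x y < e -> 0 < r -> r < e -> P y r) ->
  \forall y \near x & r \near (0 : R)^'+, P y r.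
Proof.
move=> e0 Pe.
exists ([set y | mdist x y < e], [set r : R | 0 < r < e]) => /=; first split.
- by rewrite -ballEmdist; exact: nbhsx_ballx.
- near=> r; apply/andP; split; near: r; [exact: nbhs_right_gt|exact: nbhs_right_lt].
- by move=> [y r] /= [xy /andP[r0 re]]; exact: Pe.
Unshelve. all: by end_near. Qed.

Lemma nbhs_mdistP d (x : completion d) (U : set (completion d)) :
  nbhs x U -> exists2 e : R, 0 < e & forall y, mdist x y < e -> U y.
Proof.
by move=> /nbhs_ballP[e /= e0 eU]; exists e => // y xy; apply: eU; rewrite ballEmdist.
Qed.

Lemma mdist_nbhs d (x : completion d) (e : R) : 0 < e ->
  nbhs x [set y | mdist x y < e].
Proof. by move=> e0; rewrite -ballEmdist; exact: nbhsx_ballx. Qed.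

Lemma compact_totally_bounded d : X_cpt R d -> totally_bounded_metric d.
Proof.
move=> /compact_near_coveringP cK e e0.
have [|N _ /(_ N (leqnn _)) hN] := cK nat \oo (fun N x => exists2 n, (n < N)%N &
    mdist (to_completion d n) x < e) _.
  move=> x _.
  have [|n nx] := dense_to_completion x (e := e / 2); first lra.
  exists ([set y | mdist x y < e / 2], [set N | (n < N)%N]) => /=.
    by split; [apply: mdist_nbhs; lra|exact: nbhs_infty_gt].
  move=> [y N] /= [xy nN]; exists n => //.
  by have := metric_triangle (to_completion d n) x y; lra.
exists (iota 0 N) => y.
have [n nN ny] := hN (to_completion d y) I.
by exists n; [rewrite mem_iota|rewrite -to_completion_isometry].
Qed.

Lemma clopen_unif d (V : set (completion d)) : X_cpt R d -> clopen V ->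
  exists2 r : R, 0 < r & forall y z, mdist y z < r -> V y -> V z.
Proof.
move=> /compact_near_coveringP cK [oV cV].
have [|r r0 hr] := near0P (cK R 0^'+
    (fun r y => forall z, mdist y z < r -> V y -> V z) _ _); last first.
  by exists r => // y; exact: hr.
move=> x _; case: (pselect (V x)) => Vx.
  have [e e0 eV] := nbhs_mdistP (open_nbhs_nbhs (conj oV Vx)).
  apply: (@near_ballP _ _ _ (e / 2)); first lra.
  move=> y r xy r0 re z yz _; apply: eV.
  have := metric_triangle x y z; lra.
have [e e0 eV] := nbhs_mdistP (open_nbhs_nbhs (conj (closed_openC cV) Vx)).
by apply: (@near_ballP _ _ _ e) => // y r xy r0 re z yz /(eV _ xy).
Qed.

(** Around each point there is a small clopen set, which chains of short enough steps
    cannot leave; compactness makes the bound on the steps uniform. *)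
Lemma zero_dim_small_chains d : X_0dim R d -> small_chains d.
Proof.
move=> [cK base] e e0.
have e2 : 0 < e / 2 by lra.
have [|r r0 hr] := near0P (iffLR (compact_near_coveringP _) cK R 0^'+
    (fun r y => forall a b, to_completion d a = y -> chained d r a b ->
      dist d a b < e) _ _); last first.
  by exists r => // a b; exact: (hr (to_completion d a) I).
move=> x _.
have [V [Vclopen Vx Ve]] := base x _ (mdist_nbhs x e2).
have [r r0 hr] := clopen_unif cK Vclopen.
have [t t0 tV] := nbhs_mdistP (open_nbhs_nbhs (conj (proj1 Vclopen) Vx)).
apply: (@near_ballP _ _ _ (Num.min r t)); first by rewrite lt_min r0.
move=> y r'; rewrite !lt_min => /andP[_ /tV Vy] _ /andP[r'r _] a b ay.
rewrite -ay in Vy => -[l [pl <-]].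
rewrite -to_completion_isometry.
have : V (to_completion d (last a l)).
  elim: l a Vy pl {ay} => //= c l IH a Va /andP[ac pl]; apply: IH => //.
  by apply: hr Va; rewrite to_completion_isometry; exact: lt_trans r'r.
move=> /Ve /=; have /= := Ve _ Vy.
have := metric_triangle (to_completion d a) x (to_completion d (last a l)).
by rewrite (metric_sym (to_completion d a) x); lra.
Qed.

Lemma E_csc_sym d1 d2 : E_csc d1 d2 -> E_csc d2 d1.
Proof.
move=> [f [cf [g [fg gf cg]]] fn]; exists g; last by move=> n; rewrite -fn fg.
by split=> //; exists f.
Qed.

(** A continuous map on a compact space is uniformly continuous. *)
Lemma E_csc_unif_finer d1 d2 : X_cpt R d1 -> E_csc d1 d2 -> unif_finer d1 d2.
Proof.
move=> /compact_near_coveringP cK [f [cf _] fn] e e0.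
have [|r r0 hr] := near0P (cK R 0^'+
    (fun r y => forall z, mdist y z < r -> mdist (f y) (f z) < e) _ _); last first.
  exists r => // x y xy; rewrite -to_completion_isometry -!fn; apply: hr => //.
  by rewrite to_completion_isometry.
move=> x _.
have e2 : 0 < e / 2 by lra.
have [t t0 ht] := nbhs_mdistP (cf x _ (mdist_nbhs (f x) e2)).
apply: (@near_ballP _ _ _ (t / 2)); first lra.
move=> y r xy r0 rt z yz.
have /= fxy : mdist (f x) (f y) < e / 2 by apply: ht; lra.
have fxz : mdist (f x) (f z) < e / 2.
  by apply: ht; have := metric_triangle x y z; lra.
by have := metric_triangle (f y) (f x) (f z); rewrite (metric_sym (f y) (f x)); lra.
Qed.

End uniformities.

(** * Extension to completions, and compactness criteria *)

Section extension.
Local Open Scope quotient_scope.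
Context {R : realType}.
Implicit Types d : metrics R.

Lemma unif_finer_cauchy d1 d2 (u : cauchy_seqs d1) : unif_finer d1 d2 ->
  exists v : cauchy_seqs d2, set_val v = set_val u.
Proof.
move=> U; have cu : cauchy_seqs d2 (set_val u).
  move=> e /U[r r0 hr]; have [N hN] := cauchy_seqsP u r0.
  by exists N => m n hm hn; apply: hr; exact: hN.
by exists (SigSub (mem_set cu)); rewrite !set_valE.
Qed.

Lemma unif_finer_seq_dist d1 d2 : unif_finer d1 d2 -> forall e : R, 0 < e ->
  exists2 r : R, 0 < r & forall (u1 v1 : cauchy_seqs d1) (u2 v2 : cauchy_seqs d2),
    set_val u1 = set_val u2 -> set_val v1 = set_val v2 ->
    seq_dist u1 v1 < r -> seq_dist u2 v2 < e.
Proof.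
move=> U e e0; have [|r r0 hr] := U (e / 2); first lra.
exists r => // u1 v1 u2 v2 u12 v12 uvr.
suff : seq_dist u2 v2 <= e / 2 by lra.
apply: limr_le; first exact: is_cvg_seq_dist.
rewrite -u12 -v12.
have : \forall n \near \oo, dist d1 (set_val u1 n) (set_val v1 n) < r.
  have cuv := @is_cvg_seq_dist R d1 u1 v1.
  exact: cvgr_lt cuv _ uvr.
by apply: filterS => n /hr /ltW.
Qed.

(** The identity of N, uniformly continuous from [d1] to [d2], extends to the
    completions by sending the class of a Cauchy sequence to the class of the same
    sequence. *)
Lemma unif_finer_extension d1 d2 : unif_finer d1 d2 ->
  exists2 f : completion d1 -> completion d2, continuous f &
    forall (u : cauchy_seqs d1) (v : cauchy_seqs d2), set_val u = set_val v ->
      f (\pi_(completion d1) u) = \pi_(completion d2) v.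
Proof.
move=> U.
have /choice[t ht] u := unif_finer_cauchy u U.
exists (fun x => \pi_(completion d2) (t (repr x))).
  move=> x V /nbhs_mdistP[e e0 eV].
  have [r r0 hr] := unif_finer_seq_dist U e0.
  apply: filterS (mdist_nbhs x r0) => y xy; apply: eV.
  by rewrite [ltLHS]completion_dist_pi; apply: hr xy; rewrite ht.
move=> u v uv; apply: completion_dist_eq0; rewrite completion_dist_pi.
apply/eqP; rewrite eq_le seq_dist_ge0 andbT; apply/ler_addgt0Pr => e e0.
have [r r0 hr] := unif_finer_seq_dist U e0; rewrite add0r; apply/ltW.
apply: (hr (repr (\pi u)) u); rewrite ?ht //.
suff -> : seq_dist (repr (\pi_(completion d1) u)) u = 0 by [].
by rewrite -completion_dist_pi reprK; exact: completion_distxx.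
Qed.

Lemma unif_finer_E_csc d1 d2 :
  unif_finer d1 d2 -> unif_finer d2 d1 -> E_csc d1 d2.
Proof.
move=> U12 U21.
have [f cf fE] := unif_finer_extension U12.
have [g cg gE] := unif_finer_extension U21.
exists f; last by move=> n; apply: fE; rewrite !set_valE.
split=> //; exists g; split=> // x; rewrite -[x]reprK.
  by have [v uv] := unif_finer_cauchy (repr x) U12; rewrite (fE _ v)// (gE _ (repr x)).
by have [v uv] := unif_finer_cauchy (repr x) U21; rewrite (gE _ v)// (fE _ (repr x)).
Qed.

(** The balls around a finite net cover the completion, so an ultrafilter contains a
    ball of each radius; it is therefore Cauchy, and it converges by completeness. *)
Lemma totally_bounded_compact d : totally_bounded_metric d -> X_cpt R d.
Proof.
move=> tb; rewrite /X_cpt/= compact_ultra => F UF _.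
suff /completion_cauchy_cvg Fc : cauchy F.
  by have /cvg_ex[x Fx] := Fc _; exists x.
apply/cauchyP => e e0.
have e2 : 0 < e / 2 by lra.
have [s hs] := tb _ e2.
pose B n := [set x | mdist (to_completion d n) x < e].
suff [n Fn] : exists n, F (B n) by exists (to_completion d n); rewrite ballEmdist.
apply: contrapT => nF.
have : F [set x | forall n, n \in s -> ~ B n x].
  elim: s {hs} => [|n s IH]; first by apply: filterS filterT => x _ n.
  have : F (~` B n) by case: (in_ultra_setVsetC (B n) UF) => // Bn; case: nF; exists n.
  apply: filterS2 IH => x hs nB m; rewrite inE => /orP[/eqP -> //|]; exact: hs.
move=> /filter_ex[x hx].
have [n nx] := dense_to_completion x e2.
have [m ms mn] := hs n; apply: (hx m ms); rewrite /B /=.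
have := metric_triangle (to_completion d m) (to_completion d n) x.
by rewrite to_completion_isometry; lra.
Qed.

Definition ultrametric d : Prop :=
  forall x y z, dist d x z <= Num.max (dist d x y) (dist d y z).

(** The ultrametric inequality passes to the completion, by approximation of the
    three points in N. *)
Lemma completion_ultrametric d (x y z : completion d) (e : R) : ultrametric d ->
  mdist x y <= e -> mdist y z <= e -> mdist x z <= e.
Proof.
move=> ud xy yz; apply/ler_addgt0Pr => t t0.
have t4 : 0 < t / 4 by lra.
have [a ax] := dense_to_completion x t4.
have [b bx] := dense_to_completion y t4.
have [c cx] := dense_to_completion z t4.
have := ud a b c; rewrite -!to_completion_isometry.
move: (to_completion d a) (to_completion d b) (to_completion d c) ax bx cx.
move=> {}a {}b {}c ax bx cx.
have := metric_triangle x a z; have := metric_triangle a c z.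
have := metric_triangle a x b; have := metric_triangle x y b.
have := metric_triangle b y c; have := metric_triangle y z c.
rewrite (metric_sym x a) (metric_sym y b) (metric_sym z c) le_max.
by move=> ? ? ? ? ? ? /orP[]; lra.
Qed.

Lemma ultrametric_clopen_base d : ultrametric d -> has_clopen_base (completion d).
Proof.
move=> ud x U /nbhs_mdistP[e e0 eU].
have e2 : 0 < e / 2 by lra.
exists [set y | mdist x y <= e / 2]; split; last 2 first.
- by rewrite /= mdistxx; lra.
- by move=> y /= xy; apply: eU; lra.
split; first (rewrite openE => y /= xy; have := mdist_nbhs y e2).
  by apply: filterS => z /= /ltW; exact: completion_ultrametric.
rewrite -openC openE => y /= xy; have := mdist_nbhs y e2.
apply: filterS => z /= yz xz; apply: xy; apply: completion_ultrametric xz _ => //.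
by rewrite metric_sym ltW.
Qed.

Lemma ultrametric_X_0dim d :
  totally_bounded_metric d -> ultrametric d -> X_0dim R d.
Proof.
by move=> tb ud; split; [exact: totally_bounded_compact|exact: ultrametric_clopen_base].
Qed.

End extension.

(** * Enumeration of the traces of clopen sets *)

Section chain_classes.
Context {R : realType}.
Implicit Types (d : metrics R) (m : nat) (s : seq nat) (A : set nat).

(** The union of the chain classes at scale 1/(m+1) of the members of [s]. *)
Definition chain_union d m s : set nat :=
  [set y | exists2 x, x \in s & chained d m.+1%:R^-1 x y].

Lemma chained_dist d (e : R) x y : dist d x y < e -> chained d e x y.
Proof. by move=> xy; exists [:: y]; rewrite /= xy. Qed.

Lemma chained_rcons d (e : R) x y z :
  chained d e x y -> dist d y z < e -> chained d e x z.
Proof.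
by move=> [l [pl <-]] yz; exists (rcons l z); rewrite rcons_path last_rcons pl yz.
Qed.

Lemma inv_succ_lt (e : R) : 0 < e -> exists m, m.+1%:R^-1 < e.
Proof.
move=> e0; have [N _ /(_ N (leqnn _))] := near_infty_natSinv_lt (PosNum e0).
by exists N.
Qed.

Lemma inv_succ_gt0 m : 0 < m.+1%:R^-1 :> R.
Proof. by rewrite invr_gt0 ltr0n. Qed.
Hint Resolve inv_succ_gt0 : core.

Lemma chained_closed d (e r : R) A x y : e <= r ->
  (forall a b, dist d a b < r -> A a -> A b) -> chained d e x y -> A x -> A y.
Proof.
move=> er rA [l [+ <-]]; elim: l x => //= z l IH x /andP[xz pl] Ax.
by apply: (IH z pl); apply: rA Ax; exact: lt_le_trans er.
Qed.

Lemma unif_clopen_chain_union d m s : unif_clopen d (chain_union d m s).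
Proof.
exists m.+1%:R^-1 => // y z yz [x xs xy]; exists x => //; exact: chained_rcons yz.
Qed.

(** At a small enough scale [A] is a union of chain classes, and a finite net for that
    scale meets all of them. *)
Lemma unif_clopenP d A : totally_bounded_metric d -> unif_clopen d A ->
  exists m s, A = chain_union d m s.
Proof.
move=> tb [r r0 hr]; have [m mr] := inv_succ_lt r0; exists m.
have [s hs] := tb _ (inv_succ_gt0 m).
exists [seq x <- s | `[< A x >]]; apply/seteqP; split => y.
  move=> Ay; have [x xs xy] := hs y; exists x; last exact: chained_dist.
  rewrite mem_filter xs andbT; apply/asboolP; apply: hr Ay.
  by rewrite distC; exact: lt_trans mr.
move=> [x]; rewrite mem_filter => /andP[/asboolP Ax _] xy.
exact: chained_closed (ltW mr) hr xy Ax.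
Qed.

(** The finitely many chain classes of [d2] at a small scale are small and cover N. If
    they are uniformly clopen for [d1], points close for [d1] lie in the same one. *)
Lemma unif_clopen_unif_finer d1 d2 :
  totally_bounded_metric d2 -> small_chains d2 ->
  unif_clopen d2 `<=` unif_clopen d1 -> unif_finer d1 d2.
Proof.
move=> tb sc sub e e0; have [|r r0 hr] := sc (e / 2); first lra.
have [m mr] := inv_succ_lt r0.
have [s hs] := tb _ (inv_succ_gt0 m).
have class_small x y : chained d2 m.+1%:R^-1 x y -> dist d2 x y < e / 2.
  move=> [l [pl ly]]; apply: hr; exists l; split=> //.
  by apply: sub_path pl => a b /lt_trans; exact.
have [t t0 ht] : exists2 t : R, 0 < t & forall x, x \in s -> forall a b,
    dist d1 a b < t -> chain_union d2 m [:: x] a -> chain_union d2 m [:: x] b.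
  elim: (s) => [|x l [t t0 ht]]; first by exists 1.
  have [u u0 hu] := sub _ (unif_clopen_chain_union d2 m [:: x]).
  exists (Num.min t u); first by rewrite lt_min t0.
  move=> y; rewrite inE => /orP[/eqP ->|yl] a b; rewrite lt_min => /andP[abt abu].
    exact: hu.
  exact: ht.
exists t => // a b abt; have [x xs xa] := hs a.
have [y /[!inE] /eqP -> xb] : chain_union d2 m [:: x] b.
  by apply: ht abt _ => //; exists x; [rewrite inE|exact: chained_dist].
have := class_small _ _ xb; have := class_small _ _ (chained_dist xa).
have := dist_triangle d2 x a b; rewrite (distC d2 a x); lra.
Qed.

(** The relation [E_csc] is equality of the algebras of traces of clopen sets. *)
Lemma E_cscP d1 d2 : X_0dim R d1 -> X_0dim R d2 ->
  E_csc d1 d2 <-> unif_clopen d1 = unif_clopen d2.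
Proof.
move=> z1 z2; split.
  have sub d d' : X_cpt R d' -> E_csc d' d -> unif_clopen d `<=` unif_clopen d'.
    move=> c' E A [r r0 rA]; have [t t0 ht] := E_csc_unif_finer c' E r0.
    by exists t => // x y /ht; exact: rA.
  move=> E; apply/seteqP; split; apply: sub => //; first by case: z2.
    exact: E_csc_sym.
  by case: z1.
have fine d d' : X_0dim R d' -> unif_clopen d' `<=` unif_clopen d -> unif_finer d d'.
  move=> z; apply: unif_clopen_unif_finer (zero_dim_small_chains z).
  by apply: compact_totally_bounded; case: z.
by move=> eq12; apply: unif_finer_E_csc; apply: fine; rewrite // eq12.
Qed.

End chain_classes.

Section coding.
Context {R : realType}.
Implicit Types (A B : set nat) (n m : nat).

Definition ternary_sum A n : R := \sum_(i < n) (`[< A i >])%:R * 3 ^- i.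

(** The sum of [3 ^- i] over all [i] in [A], as the supremum of its partial sums. *)
Definition ternary A : R := sup (range (ternary_sum A)).

Lemma ternary_sumS A n :
  ternary_sum A n.+1 = ternary_sum A n + (`[< A n >])%:R * 3 ^- n.
Proof. by rewrite /ternary_sum big_ord_recr. Qed.

Lemma expVS n : 3 ^- n.+1 = 3 ^- n / 3 :> R.
Proof. by rewrite exprSr invfM. Qed.

Lemma expV_gt0 n : 0 < 3 ^- n :> R.
Proof. by rewrite invr_gt0 exprn_gt0. Qed.

(** [3 / 2 * 3 ^- n] is the sum of [3 ^- i] over [i >= n]. *)
Lemma ternary_sum_le A n m :
  ternary_sum A m <= ternary_sum A n + 3 / 2 * 3 ^- n.
Proof.
have up j k : ternary_sum A j <= ternary_sum A (j + k).
  elim: k => [|k IH]; first by rewrite addn0.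
  rewrite addnS ternary_sumS; apply: le_trans IH _.
  by rewrite lerDl mulr_ge0 // ltW // expV_gt0.
have down k : ternary_sum A (n + k) + 3 / 2 * 3 ^- (n + k) <=
    ternary_sum A n + 3 / 2 * 3 ^- n.
  elim: k => [|k IH]; first by rewrite addn0.
  apply: le_trans IH; rewrite addnS ternary_sumS expVS.
  by have := expV_gt0 (n + k); case: `[< _ >] => /=; lra.
have t0 := expV_gt0 n; case: (leqP n m) => [nm|/ltnW mn].
  by have := down (m - n)%N; rewrite subnKC //; have := expV_gt0 m; lra.
by have := up m (n - m)%N; rewrite subnKC //; lra.
Qed.

Lemma ternary_sum_ub A n : ternary_sum A n <= ternary A.
Proof.
apply: ub_le_sup; last by exists n.
exists (ternary_sum A 0 + 3 / 2 * 3 ^- 0) => _ [m _ <-]; exact: ternary_sum_le.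
Qed.

Lemma ternary_le A n : ternary A <= ternary_sum A n + 3 / 2 * 3 ^- n.
Proof.
apply: ge_sup; first by exists (ternary_sum A 0); exists 0.
by move=> _ [m _ <-]; exact: ternary_sum_le.
Qed.

(** If [A] and [B] first differ at [n], the term [3 ^- n] exceeds all that follows,
    which sums to [3 ^- n / 2] at most. *)
Lemma ternary_inj : injective ternary.
Proof.
move=> A B AB.
suff h n : ternary_sum A n = ternary_sum B n /\ (A n <-> B n).
  by apply/funext => n; apply/propext; exact: (proj2 (h n)).
elim/ltn_ind: n => n IH.
have pn : ternary_sum A n = ternary_sum B n.
  by apply: eq_bigr => i _; rewrite (asbool_equiv_eq (proj2 (IH i (ltn_ord i)))).
split=> //; split => h; apply: contrapT => h'.
  have := ternary_sum_ub A n.+1; have := ternary_le B n.+1.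
  rewrite !ternary_sumS expVS (asboolT h) (asboolF h') AB pn /=.
  have := expV_gt0 n; lra.
have := ternary_sum_ub B n.+1; have := ternary_le A n.+1.
rewrite !ternary_sumS expVS (asboolT h) (asboolF h') AB pn /=.
have := expV_gt0 n; lra.
Qed.

Lemma borel_set_ternary (X : topologicalType) (A : X -> set nat) (q : R) :
  (forall n, borel_set [set x | A x n]) -> borel_set [set x | q < ternary (A x)].
Proof.
move=> bA.
rewrite (_ : [set x | _] = [set x | exists n, q < ternary_sum (A x) n]); last first.
  apply/seteqP; split => x /= => [|[n qn]]; last first.
    exact: lt_le_trans qn (ternary_sum_ub _ _).
  move=> qA; apply: contrapT => nq; move: qA; apply/negP; rewrite -leNgt.
  apply: ge_sup; first by exists (ternary_sum (A x) 0); exists 0.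
  by move=> _ [n _ <-]; rewrite leNgt; apply/negP => qn; apply: nq; exists n.
apply: (borel_set_exists (A := fun n => [set x | q < ternary_sum (A x) n])) => n.
(* the n-th partial sum only depends on the first n bits of A x *)
pose k x := [ffun i : 'I_n => `[< A x i >]].
pose S := [set t : {ffun 'I_n -> bool} | q < \sum_(i < n) (t i)%:R * 3 ^- i].
rewrite (_ : [set x | _] = [set x | S (k x)]).
  apply: borel_set_fibres => t.
  rewrite (_ : [set x | _] = [set x | forall i : 'I_n, A x i <-> t i]).
    apply: borel_set_forall => i.
    by apply: borel_set_iff; [exact: bA|exact: borel_set_cst].
  apply/seteqP; split => x /= => [<- i|h]; first by rewrite ffunE; split=> /asboolP.
  by apply/ffunP => i; rewrite ffunE; apply/asboolP/idP => /h.
by apply/seteqP; split => x; rewrite /S /=; under eq_bigr do rewrite ffunE.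
Qed.

End coding.

Section reduction_to_eq_plus.
Context {R : realType}.

(** The enumeration, by codes of pairs [(m, s)], of the sets [chain_union d m s],
    each coded by a real. Integers that code no pair give the empty set, which
    is also a [chain_union]. *)
Definition clopen_code (d : metrics R) : {ptws nat -> R} := fun n =>
  if unpickle n is Some (m, s) then ternary (chain_union d m s) else ternary set0.

Lemma range_clopen_code d : totally_bounded_metric d ->
  range (clopen_code d) = ternary @` unif_clopen d.
Proof.
move=> tb; apply/seteqP; split.
  move=> _ [n _ <-]; rewrite /clopen_code; case: (unpickle n) => [[m s]|].
    by exists (chain_union d m s) => //; exact: unif_clopen_chain_union.
  by exists set0 => //; exists 1.
move=> _ [A /(unif_clopenP tb)[m [s ->]] <-].
by exists (pickle (m, s)) => //; rewrite /clopen_code pickleK.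
Qed.

Lemma E_csc_clopen_code d1 d2 : X_0dim R d1 -> X_0dim R d2 ->
  E_csc d1 d2 <-> eq_plus (clopen_code d1) (clopen_code d2).
Proof.
move=> z1 z2; rewrite (E_cscP z1 z2) /eq_plus.
have [/compact_totally_bounded tb1 _] := z1.
have [/compact_totally_bounded tb2 _] := z2.
rewrite !range_clopen_code //.
split=> [-> //|e]; apply/seteqP; split=> A UA.
  have : (ternary @` unif_clopen d1) (ternary A : R) by exists A.
  by rewrite e => -[B UB /ternary_inj <-].
have : (ternary @` unif_clopen d2) (ternary A : R) by exists A.
by rewrite -e => -[B UB /ternary_inj <-].
Qed.

Lemma borel_set_dist_lt (x y : nat) (e : R) :
  borel_set [set d : metrics R | dist d x y < e].
Proof.
rewrite (_ : [set d | _] =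
    [set d : metrics R | (set_val @^-1` [set f | f (x, y) < e]) d]) //.
apply: borel_set_open.
have /(_ _) := @initial_continuous (metrics R) {ptws (nat * nat)%type -> R} set_val.
move=> /continuousP; apply.
apply: (open_comp (f := fun f : {ptws (nat * nat)%type -> R} => f (x, y))
  (D := [set r : R | r < e])); last exact: open_lt.
by move=> f _; exact: proj_continuous.
Qed.

Lemma borel_set_chained (x y : nat) (e : R) :
  borel_set [set d : metrics R | chained d e x y].
Proof.
apply: borel_set_exists => l; apply: borel_setI; last exact: borel_set_cst.
suff: borel_set [set d : metrics R | path (fun a b => dist d a b < e) x l] by [].
elim: l x => [|z l IH] x; first exact: (borel_set_cst (is_true true)).
rewrite (_ : [set d | _] = [set d : metrics R | dist d x z < e] `&`
    [set d | path (fun a b => dist d a b < e) z l]).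
  by apply: borel_setI => //; exact: borel_set_dist_lt.
by apply/seteqP; split=> d /= => [/andP[]|[-> ->]].
Qed.

Lemma borel_map_clopen_code : borel_map clopen_code.
Proof.
apply: borel_map_ptws => n q; rewrite /clopen_code.
case: (unpickle n) => [[m s]|]; apply: borel_set_ternary => y;
  last exact: borel_set_cst.
rewrite (_ : [set d | _] = [set d | exists x, x \in s /\ chained d m.+1%:R^-1 x y]).
  apply: borel_set_exists => x; apply: borel_setI; first exact: borel_set_cst.
  exact: borel_set_chained.
by apply/seteqP; split=> d /= [x]; [exists x|case; exists x].
Qed.

End reduction_to_eq_plus.

(** * An ultrametric coding the range of a sequence *)

Section interval_ultrametric.
Context {R : realType}.
Implicit Types (x y : {ptws nat -> R}) (r : R) (n k i j : nat).

(** The integer [i] codes the pair of rationals of index [logn 2 i], if any; [r] lies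
    in the open interval with these endpoints. As [logn 2] takes
    each value infinitely often, each pair has arbitrarily large codes. *)
Definition in_coded_interval r i : Prop :=
  if (unpickle (logn 2 i) : option (rat * rat)) is Some q
  then ratr q.1 < r /\ r < ratr q.2 else False.

Lemma coded_interval_ex (q1 q2 : rat) n : exists2 i, (n < i)%N &
  forall r, in_coded_interval r i <-> ratr q1 < r /\ r < ratr q2.
Proof.
exists (2 ^ pickle (q1, q2) * 3 ^ n)%N.
  apply: leq_trans (ltn_expl n (isT : 1 < 3)%N) _.
  by rewrite leq_pmull // expn_gt0.
move=> r; rewrite /in_coded_interval; set c := pickle _.
have -> : logn 2 (2 ^ c * 3 ^ n) = c.
  by rewrite lognM ?expn_gt0// !lognX !logn_prime//= muln1 muln0 addn0.
by rewrite pickleK.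
Qed.

(** The [k]-th test does not separate [i] from [j]: neither the singleton {k} nor the
    set of codes of intervals around [x k] does. *)
Definition same_at x k i j : Prop :=
  (i == k) = (j == k) /\ (in_coded_interval (x k) i <-> in_coded_interval (x k) j).

Definition same_upto x n i j : Prop := forall k, (k <= n)%N -> same_at x k i j.

Lemma same_upto_sym x n i j : same_upto x n i j -> same_upto x n j i.
Proof. by move=> h k /h[ij [? ?]]; split; [rewrite ij|split]. Qed.

Lemma same_upto_trans x n j i l :
  same_upto x n i j -> same_upto x n j l -> same_upto x n i l.
Proof.
move=> h h' k kn; have [ij rij] := h k kn; have [jl rjl] := h' k kn.
by split; [rewrite ij|exact: iff_trans rjl].
Qed.

Lemma same_upto_eq x i j : (forall n, same_upto x n i j) -> i = j.
Proof. by move=> /(_ i i (leqnn _))[/esym]; rewrite eqxx => /eqP. Qed.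

(** 1/(k+1), where [k] is the first test that separates the two integers, and 0 if
    there is none. *)
Definition split_dist x (ij : nat * nat) : R :=
  if pselect (exists k, `[< ~ same_at x k ij.1 ij.2 >]) is left ex_k
  then (ex_minn ex_k).+1%:R^-1 else 0.

Lemma split_distP x i j : (forall n, same_upto x n i j) /\ split_dist x (i, j) = 0 \/
  exists n, [/\ split_dist x (i, j) = n.+1%:R^-1, ~ same_upto x n i j &
    forall k, (k < n)%N -> same_upto x k i j].
Proof.
rewrite /split_dist; case: pselect => [ex_k|nex]; last first.
  left; split=> // n k _; apply: contrapT => nk; apply: nex; exists k; exact/asboolP.
case: ex_minnP => n /asboolP /= hn nmin; right; exists n; split=> //.
  by move=> /(_ n (leqnn _)).
move=> k kn l lk; apply: contrapT => /asboolP /nmin; apply/negP.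
by rewrite -ltnNge; exact: leq_ltn_trans lk kn.
Qed.

Lemma split_dist_lt x i j n :
  split_dist x (i, j) < n.+1%:R^-1 <-> same_upto x n i j.
Proof.
have [[h ->]|[m [-> nm hm]]] := split_distP x i j.
  by split=> // _; rewrite invr_gt0 ltr0n.
rewrite ltf_pV2 ?posrE ?ltr0n // ltr_nat ltnS; split; first exact: hm.
move=> h; rewrite ltnNge; apply/negP => mn; apply: nm => k km.
by apply: h; exact: leq_trans mn.
Qed.

Lemma split_dist_ge0 x i j : 0 <= split_dist x (i, j).
Proof.
by have [[_ ->]//|[m [-> _ _]]] := split_distP x i j; rewrite invr_ge0.
Qed.

Lemma split_dist_ultra x i j l :
  split_dist x (i, l) <= Num.max (split_dist x (i, j)) (split_dist x (j, l)).
Proof.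
rewrite leNgt; apply/negP; rewrite gt_max => /andP[].
have [[_ ->]|[m [-> nm _]]] := split_distP x i l.
  by rewrite ltNge split_dist_ge0.
by move=> /split_dist_lt ij /split_dist_lt jl; apply: nm; exact: same_upto_trans jl.
Qed.

Lemma split_dist_leC x i j : split_dist x (i, j) <= split_dist x (j, i).
Proof.
rewrite leNgt; apply/negP; have [[_ ->]|[m [-> nm _]]] := split_distP x i j.
  by rewrite ltNge split_dist_ge0.
by move=> /split_dist_lt /same_upto_sym.
Qed.

Lemma metrics_split_dist x : metrics R (split_dist x).
Proof.
split=> [i|i j d0|i j|i j l].
- by have [[_ ->]//|[n [_ nn _]]] := split_distP x i i; case: nn.
- apply: (same_upto_eq (x := x)) => n; apply/split_dist_lt.
  by rewrite d0 invr_gt0 ltr0n.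
- by apply/eqP; rewrite eq_le !split_dist_leC.
- apply: le_trans (split_dist_ultra x i j l) _.
  by rewrite ge_max lerDl lerDr !split_dist_ge0.
Qed.

Definition split_metric x : metrics R := SigSub (mem_set (metrics_split_dist x)).

Lemma split_metricE x i j : dist (split_metric x) i j = split_dist x (i, j).
Proof. by rewrite /dist set_valE. Qed.

(** Only finitely many patterns of answers to the first [n + 1] tests are possible;
    one integer is chosen for each that occurs. *)
Lemma split_metric_totally_bounded x : totally_bounded_metric (split_metric x).
Proof.
move=> e /inv_succ_lt[n ne].
pose signature i := [ffun k : 'I_n.+1 =>
  (i == k :> nat, `[< in_coded_interval (x k) i >])].
exists [seq xget 0%N [set i | signature i = t] |
  t <- enum {: {ffun 'I_n.+1 -> bool * bool}}].
move=> j; exists (xget 0%N [set i | signature i = signature j]).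
  by apply/mapP; exists (signature j); rewrite ?mem_enum.
case: xgetP => [i _ /= sij|/(_ j)[]//].
rewrite split_metricE; apply: lt_trans ne; apply/split_dist_lt => k.
rewrite -ltnS => kn; have /ffunP/(_ (Ordinal kn)) := sij.
by rewrite !ffunE => -[ijk rij]; split=> //; exact: asbool_eq_equiv.
Qed.

Lemma split_metric_X_0dim x : X_0dim R (split_metric x).
Proof.
apply: ultrametric_X_0dim; first exact: split_metric_totally_bounded.
by move=> i j l; rewrite !split_metricE; exact: split_dist_ultra.
Qed.

Lemma sub_range_unif_finer x y : range x `<=` range y ->
  unif_finer (split_metric y) (split_metric x).
Proof.
move=> xy e /inv_succ_lt[n ne].
have /choice[g yg] k : exists l, y l = x k.
  by have [|l _ <-] := xy (x k); [exists k|exists l].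
pose m := maxn n (\max_(k < n.+1) g k).
exists m.+1%:R^-1; first by rewrite invr_gt0 ltr0n.
move=> i j; rewrite !split_metricE => /split_dist_lt ij; apply: lt_trans ne.
apply/split_dist_lt => k kn; split.
  by have [] := ij k _ => //; rewrite leq_max kn.
rewrite -yg; have [] // := ij (g k) _; rewrite leq_max; apply/orP; right.
exact: (leq_bigmax (Ordinal (kn : (k < n.+1)%N))).
Qed.

Lemma far_from_finite y r n : ~ range y r ->
  exists2 e : R, 0 < e & forall k, (k <= n)%N -> e <= `|y k - r|.
Proof.
move=> yr; have pos k : 0 < `|y k - r|.
  by rewrite normr_gt0 subr_eq0; apply/eqP => ykr; apply: yr; exists k.
elim: n => [|n [e e0 he]].
  by exists `|y 0%N - r| => // k; rewrite leqn0 => /eqP ->.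
exists (Num.min e `|y n.+1 - r|); first by rewrite lt_min e0 pos.
move=> k; rewrite leq_eqVlt ge_min => /orP[/eqP ->|/he ->//].
by rewrite lexx orbT.
Qed.

Lemma unif_finer_sub_range x y :
  unif_finer (split_metric y) (split_metric x) -> range x `<=` range y.
Proof.
move=> U _ [k _ <-]; apply: contrapT => yxk.
have [|r r0 hr] := U k.+1%:R^-1; first by rewrite invr_gt0 ltr0n.
have [m mr] := inv_succ_lt r0.
have [e e0 he] := far_from_finite m yxk.
have [|q1] := @rat_in_itvoo _ (x k - e) (x k); first lra.
have [|q2] := @rat_in_itvoo _ (x k) (x k + e); first lra.
rewrite !in_itv /= => /andP[xq2 q2e] /andP[q1e q1x].
have [i mi iE] := coded_interval_ex q1 q2 m.
have [j mj jE] := coded_interval_ex 0 0 m.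
(* both codes exceed m, so the singletons {0}, ..., {m} do not separate them *)
have ij : same_upto y m i j.
  move=> l lm; split.
    by rewrite (gtn_eqF (leq_ltn_trans lm mi)) (gtn_eqF (leq_ltn_trans lm mj)).
  rewrite iE jE; split=> -[]; last lra.
  have := he l lm; rewrite ler_normr => /orP[]; lra.
have : same_upto x k i j.
  apply/split_dist_lt; rewrite -split_metricE; apply: hr.
  by rewrite split_metricE; apply: lt_trans mr; exact/split_dist_lt.
move=> /(_ k (leqnn _))[_]; rewrite iE jE => -[+ _].
by move=> /(_ (conj q1x xq2)); lra.
Qed.

Lemma eq_plus_split_metric x y :
  eq_plus x y <-> E_csc (split_metric x) (split_metric y).
Proof.
split=> [xy|E].
  by apply: unif_finer_E_csc; apply: sub_range_unif_finer; rewrite xy.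
have [cx _] := split_metric_X_0dim x; have [cy _] := split_metric_X_0dim y.
by apply/seteqP; split; apply: unif_finer_sub_range;
  apply: E_csc_unif_finer => //; exact: E_csc_sym.
Qed.

Lemma borel_set_same_at k i j : borel_set [set x | same_at x k i j].
Proof.
have bi l : borel_set [set x : {ptws nat -> R} | in_coded_interval (x k) l].
  rewrite /in_coded_interval; case: unpickle => [q|]; last exact: borel_set_cst.
  have lo := borel_set_eval k (@open_gt R (ratr q.1)).
  have hi := borel_set_eval k (@open_lt R (ratr q.2)).
  exact: borel_setI lo hi.
by apply: borel_setI; [exact: borel_set_cst|exact: borel_set_iff (bi i) (bi j)].
Qed.

(** The set where [q < split_dist x (i, j)] is a countable Boolean combination of the
    open conditions that [x k] lie in a given rational interval. *)
Lemma borel_map_split_metric : borel_map split_metric.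
Proof.
apply: borel_map_set_val; apply: borel_map_ptws => -[i j] q.
rewrite (_ : [set x | _] = [set x : {ptws nat -> R} | 0 <= ratr q :> R ->
    (~` [set x | forall n, ratr q < n.+1%:R^-1 :> R -> same_upto x n i j]) x]).
  apply: borel_set_imply; first exact: borel_set_cst.
  apply: borel_setC; apply: borel_set_forall => n.
  apply: borel_set_imply; first exact: borel_set_cst.
  apply: borel_set_forall => k; apply: borel_set_imply; first exact: borel_set_cst.
  exact: borel_set_same_at.
apply/seteqP; split=> x /=; rewrite set_valE /=.
  move=> qd q0 h; have [[_ d0]|[n [dn nn _]]] := split_distP x i j; first lra.
  by apply: nn; apply: h; rewrite -dn.
have := split_dist_ge0 x i j; have [q0|q0] := leP 0 (ratr q : R); last by move=> *; lra.
move=> d0 h; rewrite ltNge; apply/negP => dq; apply: (h isT) => n qn.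
apply/split_dist_lt; exact: le_lt_trans qn.
Qed.

End interval_ultrametric.

Section reductions.
Context {R : realType}.

Lemma E_csc_borel_reducible_eq_plus : borel_reducible
  (fun d1 d2 : X_0dim R => E_csc (set_val d1) (set_val d2)) (@eq_plus R).
Proof.
exists (fun d : X_0dim R => clopen_code (set_val d)).
  move=> B /borel_map_clopen_code.
  apply: (@borel_map_continuous (X_0dim R) (metrics R) set_val).
  exact: initial_continuous.
by move=> d1 d2; apply: E_csc_clopen_code; exact: set_valP.
Qed.

Lemma eq_plus_borel_reducible_E_csc : borel_reducible (@eq_plus R)
  (fun d1 d2 : X_0dim R => E_csc (set_val d1) (set_val d2)).
Proof.
exists (fun x => SigSub (mem_set (split_metric_X_0dim x)) : X_0dim R).
  by apply: borel_map_set_val; exact: borel_map_split_metric.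
by move=> x y; rewrite !set_valE; exact: eq_plus_split_metric.
Qed.

End reductions.

Theorem theorem1p2 (R : realType) :
  borel_bireducible
    (fun d1 d2 : X_0dim R => E_csc (set_val d1) (set_val d2))
    (@eq_plus R).
Proof.
split; [exact: E_csc_borel_reducible_eq_plus|exact: eq_plus_borel_reducible_E_csc].
Qed.
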